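(* Let $\Omega_D\subseteq\mathbb{H}$ be a slice domain and let $f:\Omega_{D}\to\hat{\mathbb{H}}=\mathbb{H}\cup\{\infty\}$ be a slice preserving semiregular function. If $q\in\Omega_D$ is a pole of $f$, then $\mathrm{ord}_f(q')=\mathrm{ord}_f(q)$ for all $q'\in\mathbb{S}_q$.
   Context: $\mathbb{H}$ denotes the quaternions with conjugation $x^c$, $\mathbb{S}=\{I\in\mathbb{H}: I^2=-1\}$, $\mathbb{C}_I=\mathbb{R}+I\mathbb{R}$, $\mathbb{S}_{\alpha+I\beta}=\{\alpha+J\beta: J\in\mathbb{S}\}$. Let $\mathbb{H}_{\mathbb{C}}=\mathbb{H}\otimes_{\mathbb{R}}\mathbb{C}=\{p+\imath q: p,q\in\mathbb{H}\}$ with product $(p_1+\imath q_1)(p_2+\imath q_2)=p_1p_2-q_1q_2+\imath(p_1q_2+q_1p_2)$ and $\overline{p+\imath q}=p-\imath q$. For an open $D\subseteq\mathbb{C}$ symmetric under complex conjugation, $\Omega_D=\{\alpha+I\beta:\alpha+i\beta\in D, I\in\mathbb{S}\}$; it is assumed to be a domain, and is a slice domain if $D\cap\mathbb{R}\neq\emptyset$. A stem function is $F=F_1+\imath F_2:D\to\mathbb{H}_{\mathbb{C}}$ with $F(\bar z)=\overline{F(z)}$; it induces the slice function $f=\mathcal{I}(F)$, $f(\alpha+I\beta)=F_1(\alpha+i\beta)+IF_2(\alpha+i\beta)$. $f$ is regular if $F$ is $C^1$ and $\partial F/\partial\alpha+\imath\,\partial F/\partial\beta=0$, and slice preserving if $f(\Omega_D\cap\mathbb{C}_J)\subset\mathbb{C}_J$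 for all $J\in\mathbb{S}$ (where $f$ is finite). The slice product is $\mathcal{I}(F)*\mathcal{I}(G)=\mathcal{I}(FG)$, the slice conjugate $f^c=\mathcal{I}(F_1^c+\imath F_2^c)$, the symmetrization $f^s=f^c*f$, the slice reciprocal $f^{-*}=(f^s)^{-1}f^c$ off the zeros of $f^s$; $(x-q)^{*n}$ denotes the $n$-th $*$-power, $n\in\mathbb{Z}$. Poles. For $q=\alpha+I\beta$ and $R>0$ let $A_I(q,0,R)=\{z\in\mathbb{C}_I: 0<|z-q|<R\}$, let $\Omega(q,0,R)=\{u+Jv: J\in\mathbb{S},\ 0<|u+iv-(\alpha+i\beta)|<R,\ 0<|u+iv-(\alpha-i\beta)|<R\}$ and $\Sigma(q,0,R)=\Omega(q,0,R)\cup A_I(q,0,R)$. If $f$ is regular on a circular open set containing $\Sigma(q,0,R)$ for some $R>0$, then $q$ is a singularity of $f$ and $f$ has a unique Laurent expansion $f(x)=\sum_{n\in\mathbb{Z}}(x-q)^{*n}a_n$ on $\Sigma(q,0,R)$, $a_n\in\mathbb{H}$. The singularity is removable if $f$ extends to a neighborhood of $q$ as a regular function; otherwise $q$ is a pole if there is $m\geq0$ with $a_{-k}=0$ for all $k>m$, and the minimum such $m$ is the order $\mathrm{ord}_f(q)$. A function on $\Omega_D$ is semiregular if it is regular on some circular open $\Omega_{D'}\subset\Omega_D$ and every point of $\Omega_D\setminus\Omega_{D'}$ is a pole or a removable singularity; it is given the value $\infty$ at poles. *)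

(* Defs.v *)
From HB Require Import structures.
From mathcomp Require Import all_boot all_order all_algebra.
From mathcomp Require Import all_classical all_reals all_analysis.
From mathcomp Require Import ring lra.

Set Implicit Arguments.
Unset Strict Implicit.
Unset Printing Implicit Defensive.

Import Order.TTheory GRing.Theory Num.Theory.
Import numFieldNormedType.Exports.

Local Open Scope classical_set_scope.
Local Open Scope ring_scope.

(** [Quat a b c d] is a + bi + cj + dk.  A fresh record is used, not a product
    of copies of R, so that unification never falls back on the componentwise
    ring structure of products. *)
Record quat (R : realType) : Type :=
  Quat { qre : R; qi : R; qj : R; qk : R }.

Section Quaternions.
Variable R : realType.
Implicit Types (x y z : quat R) (a : R).

Definition quat_tuple x := (qre x, qi x, qj x, qk x).
Definition tuple_quat (u : R * R * R * R) := Quat u.1.1.1 u.1.1.2 u.1.2 u.2.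

Lemma quat_tupleK : cancel quat_tuple tuple_quat. Proof. by case. Qed.

HB.instance Definition _ := Equality.copy (quat R) (can_type quat_tupleK).
HB.instance Definition _ := Choice.copy (quat R) (can_type quat_tupleK).

Definition qzero : quat R := Quat 0 0 0 0.

Definition qadd x y : quat R :=
  Quat (qre x + qre y) (qi x + qi y) (qj x + qj y) (qk x + qk y).

Definition qopp x : quat R := Quat (- qre x) (- qi x) (- qj x) (- qk x).

Definition qone : quat R := Quat 1 0 0 0.

Definition qmul x y : quat R :=
  let: Quat a b c d := x in let: Quat e f g h := y in
  Quat (a * e - b * f - c * g - d * h)
       (a * f + b * e + c * h - d * g)
       (a * g - b * h + c * e + d * f)
       (a * h + b * g - c * f + d * e).

Definition qscale a x : quat R :=
  Quat (a * qre x) (a * qi x) (a * qj x) (a * qk x).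

Definition qconj x : quat R := Quat (qre x) (- qi x) (- qj x) (- qk x).

Definition qnormsq x : R := qre x ^+ 2 + qi x ^+ 2 + qj x ^+ 2 + qk x ^+ 2.

Definition qnorm x : R := Num.sqrt (qnormsq x).

Definition qinv x : quat R := qscale (qnormsq x)^-1 (qconj x).

Lemma qaddA : associative qadd.
Proof. by move=> [? ? ? ?] [? ? ? ?] [? ? ? ?]; rewrite /qadd /= !addrA. Qed.

Lemma qaddC : commutative qadd.
Proof.
by move=> [a b c d] [e f g h]; rewrite /qadd /=; congr Quat; rewrite addrC.
Qed.

Lemma qadd0 : left_id qzero qadd.
Proof. by move=> [? ? ? ?]; rewrite /qadd /= !add0r. Qed.

Lemma qaddN : left_inverse qzero qopp qadd.
Proof. by move=> [? ? ? ?]; rewrite /qadd /= !addNr. Qed.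

HB.instance Definition _ :=
  GRing.isZmodule.Build (quat R) qaddA qaddC qadd0 qaddN.

Lemma qaddE x y : x + y = qadd x y. Proof. by []. Qed.

Lemma qmulA : associative qmul.
Proof.
by move=> [a b c d] [e f g h] [k l m n] /=; congr Quat; ring.
Qed.

Lemma qmul1l : left_id qone qmul.
Proof. by move=> [a b c d] /=; congr Quat; ring. Qed.

Lemma qmul1r : right_id qone qmul.
Proof. by move=> [a b c d] /=; congr Quat; ring. Qed.

Lemma qmulDl : left_distributive qmul qadd.
Proof.
by move=> [a b c d] [e f g h] [k l m n]; rewrite /qadd /=; congr Quat; ring.
Qed.

Lemma qmulDr : right_distributive qmul qadd.
Proof.
by move=> [a b c d] [e f g h] [k l m n]; rewrite /qadd /=; congr Quat; ring.
Qed.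

Lemma qone_neq0 : qone != qzero.
Proof. by apply/eqP => -[] /eqP; rewrite oner_eq0. Qed.

HB.instance Definition _ := GRing.Zmodule_isNzRing.Build (quat R)
  qmulA qmul1l qmul1r qmulDl qmulDr qone_neq0.

Lemma qscaleA a b x : qscale a (qscale b x) = qscale (a * b) x.
Proof. by rewrite /qscale /= !mulrA. Qed.

Lemma qscale1 : left_id 1 qscale.
Proof. by move=> [? ? ? ?]; rewrite /qscale /= !mul1r. Qed.

Lemma qscaleDr : right_distributive qscale +%R.
Proof.
by move=> k x y; rewrite !qaddE /qscale /qadd /=; congr Quat; ring.
Qed.

Lemma qscaleDl x : {morph qscale^~ x : a b / a + b}.
Proof.
by move=> a b; rewrite !qaddE /qscale /qadd /=; congr Quat; ring.
Qed.

HB.instance Definition _ := GRing.Zmodule_isLmodule.Build R (quat R)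
  qscaleA qscale1 qscaleDr qscaleDl.

Lemma qscaleAl a x y : a *: (x * y) = (a *: x) * y.
Proof.
case: x y => [? ? ? ?] [? ? ? ?].
by rewrite /GRing.scale /GRing.mul /= /qscale /=; congr Quat; ring.
Qed.

HB.instance Definition _ := GRing.Lmodule_isLalgebra.Build R (quat R) qscaleAl.

Lemma qscaleAr a x y : a *: (x * y) = x * (a *: y).
Proof.
case: x y => [? ? ? ?] [? ? ? ?].
by rewrite /GRing.scale /GRing.mul /= /qscale /=; congr Quat; ring.
Qed.

HB.instance Definition _ := GRing.Lalgebra_isAlgebra.Build R (quat R) qscaleAr.

Lemma qnormsq_ge0 x : 0 <= qnormsq x.
Proof. by rewrite /qnormsq !addr_ge0 ?sqr_ge0. Qed.

Lemma qnormsq_eq0 x : (qnormsq x == 0) = (x == 0).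
Proof.
apply/eqP/eqP => [|->]; last by rewrite /qnormsq /= expr0n /= !addr0.
case: x => a b c d; rewrite /qnormsq /= => h.
have := sqr_ge0 a; have := sqr_ge0 b; have := sqr_ge0 c; have := sqr_ge0 d.
move=> hd hc hb ha.
have /eqP : a ^+ 2 = 0 by lra.
have /eqP : b ^+ 2 = 0 by lra.
have /eqP : c ^+ 2 = 0 by lra.
have /eqP : d ^+ 2 = 0 by lra.
by rewrite !sqrf_eq0 => /eqP-> /eqP-> /eqP-> /eqP->.
Qed.

Lemma qmulVq : {in [pred x | x != 0], left_inverse 1 qinv *%R}.
Proof.
move=> x; rewrite inE -qnormsq_eq0; case: x => a b c d; rewrite /qnormsq /= => h.
rewrite /GRing.mul /GRing.one /= /qone /qinv /qscale /qnormsq /=.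
by congr Quat; field.
Qed.

Lemma qmulqV : {in [pred x | x != 0], right_inverse 1 qinv *%R}.
Proof.
move=> x; rewrite inE -qnormsq_eq0; case: x => a b c d; rewrite /qnormsq /= => h.
rewrite /GRing.mul /GRing.one /= /qone /qinv /qscale /qnormsq /=.
by congr Quat; field.
Qed.

Lemma qunitP x y : y * x = 1 /\ x * y = 1 -> [pred x | x != 0] x.
Proof.
move=> -[yx _] /=; apply/eqP => x0; move: yx; rewrite x0 mulr0 => /esym/eqP.
by rewrite oner_eq0.
Qed.

Lemma qinv_out : {in [predC [pred x | x != 0]], qinv =1 id}.
Proof.
move=> x; rewrite !inE negbK => /eqP ->.
by rewrite /qinv /qscale /= !oppr0 !mulr0.
Qed.

HB.instance Definition _ := GRing.NzRing_hasMulInverse.Build (quat R)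
  qmulVq qmulqV qunitP qinv_out.

Lemma qnormD x y : qnorm (x + y) <= qnorm x + qnorm y.
Proof.
have x0 := qnormsq_ge0 x; have y0 := qnormsq_ge0 y.
have nx : qnorm x ^+ 2 = qnormsq x by rewrite sqr_sqrtr.
have ny : qnorm y ^+ 2 = qnormsq y by rewrite sqr_sqrtr.
have nx0 : 0 <= qnorm x by exact: sqrtr_ge0.
have ny0 : 0 <= qnorm y by exact: sqrtr_ge0.
rewrite -(@ler_pXn2r _ 2) ?nnegrE ?sqrtr_ge0 ?addr_ge0//.
rewrite sqr_sqrtr ?qnormsq_ge0// sqrrD nx ny.
pose p := qre x * qre y + qi x * qi y + qj x * qj y + qk x * qk y.
have hp : p <= qnorm x * qnorm y.
  apply: (le_trans (ler_norm p)).
  rewrite -(@ler_pXn2r _ 2) ?nnegrE ?mulr_ge0// real_normK ?num_real//.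
  rewrite exprMn nx ny /p /qnormsq -subr_ge0.
  case: x y {x0 y0 nx ny nx0 ny0 p} => [a b c d] [e f g h] /=.
  have -> : (a ^+ 2 + b ^+ 2 + c ^+ 2 + d ^+ 2)
      * (e ^+ 2 + f ^+ 2 + g ^+ 2 + h ^+ 2)
      - (a * e + b * f + c * g + d * h) ^+ 2
    = (a * f - b * e) ^+ 2 + (a * g - c * e) ^+ 2 + (a * h - d * e) ^+ 2
      + (b * g - c * f) ^+ 2 + (b * h - d * f) ^+ 2 + (c * h - d * g) ^+ 2.
    by ring.
  by rewrite !addr_ge0 ?sqr_ge0.
have -> : qnormsq (x + y) = qnormsq x + p *+ 2 + qnormsq y.
  by rewrite qaddE /qnormsq /p /=; ring.
by rewrite lerD2r lerD2l lerMn2r.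
Qed.

Lemma qnormZ a x : qnorm (a *: x) = `|a| * qnorm x.
Proof.
rewrite /qnorm -sqrtr_sqr -sqrtrM ?sqr_ge0//; congr Num.sqrt.
by rewrite /qnormsq /=; ring.
Qed.

Lemma qnorm0_eq0 x : qnorm x = 0 -> x = 0.
Proof.
move=> h; apply/eqP; rewrite -qnormsq_eq0.
by rewrite -(sqr_sqrtr (qnormsq_ge0 x)) -/(qnorm x) h expr0n.
Qed.

(** The norm of the normed space of quaternions is the Euclidean modulus. *)
HB.instance Definition _ := Lmodule_isNormed.Build R (quat R)
  qnormD qnormZ qnorm0_eq0.

Definition qim x : quat R := x - (qre x)%:A.

End Quaternions.

(** H (x)_R C : [HC p q] is p + iota q. *)
Record hc (R : realType) : Type := HC { hc1 : quat R; hc2 : quat R }.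

Section ComplexifiedQuaternions.
Variable R : realType.
Implicit Types u v w : hc R.

Definition hc_pair u := (hc1 u, hc2 u).
Definition pair_hc (u : quat R * quat R) := HC u.1 u.2.

Lemma hc_pairK : cancel hc_pair pair_hc. Proof. by case. Qed.

HB.instance Definition _ := Equality.copy (hc R) (can_type hc_pairK).
HB.instance Definition _ := Choice.copy (hc R) (can_type hc_pairK).

Definition hczero : hc R := HC 0 0.
Definition hcadd u v : hc R := HC (hc1 u + hc1 v) (hc2 u + hc2 v).
Definition hcopp u : hc R := HC (- hc1 u) (- hc2 u).
Definition hcone : hc R := HC 1 0.

Definition hcmul u v : hc R :=
  HC (hc1 u * hc1 v - hc2 u * hc2 v) (hc1 u * hc2 v + hc2 u * hc1 v).

Definition hciota : hc R := HC 0 1.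

(** The conjugation p + iota q |-> p - iota q. *)
Definition hcbar u : hc R := HC (hc1 u) (- hc2 u).

(** The conjugation p + iota q |-> p^c + iota q^c. *)
Definition hcconj u : hc R := HC (qconj (hc1 u)) (qconj (hc2 u)).

Lemma hcaddA : associative hcadd.
Proof. by move=> u v w; rewrite /hcadd /= !addrA. Qed.

Lemma hcaddC : commutative hcadd.
Proof. by move=> u v; rewrite /hcadd; congr HC; rewrite addrC. Qed.

Lemma hcadd0 : left_id hczero hcadd.
Proof. by case=> ? ?; rewrite /hcadd /= !add0r. Qed.

Lemma hcaddN : left_inverse hczero hcopp hcadd.
Proof. by move=> u; rewrite /hcadd /= !addNr. Qed.

HB.instance Definition _ :=
  GRing.isZmodule.Build (hc R) hcaddA hcaddC hcadd0 hcaddN.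

Lemma hcmulA : associative hcmul.
Proof.
move=> [a b] [c d] [e f]; rewrite /hcmul /=.
rewrite !(mulrBl, mulrBr, mulrDl, mulrDr) !mulrA !opprD !addrA.
congr HC; first by rewrite addrAC [X in X - _]addrAC addrAC.
by rewrite addrAC [X in X + _]addrAC.
Qed.

Lemma hcmul1l : left_id hcone hcmul.
Proof. by case=> ? ?; rewrite /hcmul /= !mul1r !mul0r subr0 addr0. Qed.

Lemma hcmul1r : right_id hcone hcmul.
Proof. by case=> ? ?; rewrite /hcmul /= !mulr1 !mulr0 subr0 add0r. Qed.

Lemma hcmulDl : left_distributive hcmul hcadd.
Proof.
move=> [a b] [c d] [e f]; rewrite /hcmul /hcadd /= !mulrDl.
by congr HC; rewrite ?opprD addrACA.
Qed.

Lemma hcmulDr : right_distributive hcmul hcadd.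
Proof.
move=> [a b] [c d] [e f]; rewrite /hcmul /hcadd /= !mulrDr.
by congr HC; rewrite ?opprD addrACA.
Qed.

Lemma hcone_neq0 : hcone != hczero.
Proof. by apply/eqP => -[] /eqP; rewrite oner_eq0. Qed.

HB.instance Definition _ := GRing.Zmodule_isNzRing.Build (hc R)
  hcmulA hcmul1l hcmul1r hcmulDl hcmulDr hcone_neq0.

End ComplexifiedQuaternions.

Section SliceFunctions.
Variable R : realType.
Implicit Types (D E : set (R * R)) (I J q x : quat R) (F G : R * R -> hc R).
Implicit Types (f g : quat R -> option (quat R)) (a : int -> quat R).

Definition imag_unit : set (quat R) := [set I | I * I = -1].

Definition slice_plane I : set (quat R) :=
  [set x | exists s t : R, x = s%:A + t *: I].

(** For real q this is {q}. *)
Definition sphere_of q : set (quat R) :=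
  [set x | exists2 J, imag_unit J & x = (qre q)%:A + `|qim q| *: J].

(** The complex plane is R * R, [(s, t)] standing for s + i t. *)
Definition conj_symmetric D := forall s t : R, D (s, t) -> D (s, - t).

Definition Omega D : set (quat R) :=
  [set x | exists s t I, [/\ D (s, t), imag_unit I & x = s%:A + t *: I]].

Definition slice_domain D :=
  [/\ open D, conj_symmetric D, open (Omega D), connected (Omega D)
    & exists s : R, D (s, 0)].

Definition stem D F :=
  forall s t : R, D (s, t) -> F (s, - t) = hcbar (F (s, t)).

(** The induced function I(F), evaluated through the representation
    x = Re x + I |Im x| with I = Im x / |Im x|.  On the real axis I is the
    junk value 0, which is harmless since there the second component of a stem
    function vanishes; see [induced_stemE]. *)
Definition induced F x : quat R :=
  let t := `|qim x| in
  hc1 (F (qre x, t)) + (t^-1 *: qim x) * hc2 (F (qre x, t)).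

Definition dalpha (h : R * R -> quat R) : R * R -> quat R :=
  'D_((1, 0) : R * R) h.
Definition dbeta (h : R * R -> quat R) : R * R -> quat R :=
  'D_((0, 1) : R * R) h.

Definition C1_on D (h : R * R -> quat R) := forall z, D z ->
  [/\ derivable h z ((1, 0) : R * R), derivable h z ((0, 1) : R * R),
      {for z, continuous (dalpha h)} & {for z, continuous (dbeta h)}].

Definition holomorphic_on D F :=
  let F1 z := hc1 (F z) in let F2 z := hc2 (F z) in
  [/\ C1_on D F1, C1_on D F2 & forall z, D z ->
    HC (dalpha F1 z) (dalpha F2 z)
    + hciota R * HC (dbeta F1 z) (dbeta F2 z) = 0].

(** Functions with values in the quaternions and infinity are modelled by
    [option], [None] being infinity. *)
Definition regular_on D f :=
  [/\ open D, conj_symmetric D &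
    exists F, [/\ stem D F, holomorphic_on D F
      & forall x, Omega D x -> f x = Some (induced F x)]].

Definition slice_preserving D f := forall J, imag_unit J ->
  forall x y, Omega D x -> slice_plane J x -> f x = Some y -> slice_plane J y.

(** The slice reciprocal of I(F).  Its junk value at the zeros of the
    symmetrization is 0, since 0^-1 = 0. *)
Definition star_recip F x : quat R :=
  (induced (fun z => hcconj (F z) * F z) x)^-1
  * induced (fun z => hcconj (F z)) x.

(** The stem function of x - q. *)
Definition lin_stem q (z : R * R) : hc R := HC (z.1%:A - q) z.2%:A.

(** [star_pow q n x] is the value at x of the n-th star power of x - q;
    [Negz k] is - (k + 1). *)
Definition star_pow q (n : int) : quat R -> quat R :=
  match n with
  | Posz k => induced (fun z => lin_stem q z ^+ k)
  | Negz k => star_recip (fun z => lin_stem q z ^+ k.+1)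
  end.

Definition cdist (s t u v : R) : R := Num.sqrt ((s - u) ^+ 2 + (t - v) ^+ 2).

(** The set A_I(q,0,r).  A non-real q lies in a single plane C_I.  For real q
    the union over all I is taken: each of these sets is contained in
    Omega(q,0,r), so that Sigma(q,0,r) does not depend on I. *)
Definition slice_annulus q (r : R) : set (quat R) :=
  [set x | exists I, [/\ imag_unit I, slice_plane I q, slice_plane I x
                       & 0 < `|x - q| < r]].

Definition Omega_annulus q (r : R) : set (quat R) :=
  [set x | exists u v J, let s := qre q in let t := `|qim q| in
    [/\ imag_unit J, x = u%:A + v *: J,
        0 < cdist u v s t < r & 0 < cdist u v s (- t) < r]].

Definition Sigma_annulus q (r : R) : set (quat R) :=
  Omega_annulus q r `|` slice_annulus q r.

Definition regular_around q (r : R) f :=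
  0 < r /\ exists D, Sigma_annulus q r `<=` Omega D /\ regular_on D f.

Definition singularity f q := exists r, regular_around q r f.

Definition laurent_sum q a x (y : quat R) := exists y1 y2 : quat R,
  [/\ series (fun n : nat => star_pow q (Posz n) x * a (Posz n)) @ \oo --> y1,
      series (fun n : nat => star_pow q (Negz n) x * a (Negz n)) @ \oo --> y2
    & y = y1 + y2].

(** The family a is unique, so [exists a, laurent_expansion f q a /\ _] is a
    statement about the Laurent coefficients of f at q. *)
Definition laurent_expansion f q a := exists r, regular_around q r f /\
  forall x, Sigma_annulus q r x ->
    exists2 y, f x = Some y & laurent_sum q a x y.

(** The extension is compared with f off the sphere of q: a regular function
    lives on a circular set, and f may be infinite on that sphere. *)
Definition removable f q := singularity f q /\ exists D g,
  [/\ Omega D q, regular_on D g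
    & forall x, Omega D x -> ~ sphere_of q x -> g x = f x].

Definition pole_bound f q (m : nat) := exists2 a, laurent_expansion f q a
  & forall k : nat, (m < k)%N -> a (- k%:Z) = 0.

Definition is_pole f q :=
  [/\ singularity f q, ~ removable f q & exists m, pole_bound f q m].

(** The least m such that [pole_bound f q m]; only meaningful if there is one. *)
Definition pole_order f q : nat := xget 0%N
  [set m | pole_bound f q m /\ forall m', pole_bound f q m' -> (m <= m')%N].

Definition semiregular D f :=
  (exists E, [/\ Omega E `<=` Omega D, regular_on E f
     & forall x, Omega D x -> ~ Omega E x -> is_pole f x \/ removable f x])
  /\ forall x, Omega D x -> (f x = None <-> is_pole f x).

(** Consistency of [induced] with the formula F1(s + i t) + I F2(s + i t). *)
Lemma imag_unitP I : imag_unit I -> qre I = 0 /\ qnormsq I = 1.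
Proof.
case: I => a b c d [] /=; rewrite /qnormsq /= => ha hb hc hd.
have hn : b ^+ 2 + c ^+ 2 + d ^+ 2 = 1 + a ^+ 2 by lra.
have a0 : a = 0.
  apply/eqP; apply: contraT => an0.
  have e0 (e : R) : a * e + e * a = 0 -> e = 0.
    by move=> h; apply: (mulfI an0); rewrite mulr0; lra.
  have b0 : b = 0 by apply: e0; lra.
  have c0 : c = 0 by apply: e0; lra.
  have d0 : d = 0 by apply: e0; lra.
  by move: hn; rewrite b0 c0 d0; have := sqr_ge0 a; lra.
by split=> //; move: hn; rewrite a0; lra.
Qed.

Lemma qre_repr (s t : R) I : imag_unit I -> qre (s%:A + t *: I) = s.
Proof. by move=> /imag_unitP[/= -> _]; rewrite mulr0 addr0 mulr1. Qed.

Lemma qim_repr (s t : R) I : imag_unit I -> qim (s%:A + t *: I) = t *: I.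
Proof. by move=> hI; rewrite /qim qre_repr// addrAC subrr add0r. Qed.

Lemma qnorm_repr (t : R) I : imag_unit I -> `|t *: I| = `|t|.
Proof.
move=> /imag_unitP[_ hI]; rewrite normrZ.
by have -> : `|I| = qnorm I by []; rewrite /qnorm hI sqrtr1 mulr1.
Qed.

Lemma induced_stemE D F (s t : R) I : stem D F -> D (s, t) -> imag_unit I ->
  induced F (s%:A + t *: I) = hc1 (F (s, t)) + I * hc2 (F (s, t)).
Proof.
move=> hF hD hI; rewrite /induced qre_repr// qim_repr// qnorm_repr//.
case: (ltrgt0P t) => [t0|t0|t0].
- by rewrite scalerA mulVf ?gt_eqF// scale1r.
- rewrite hF//= scalerA invrN mulNr mulVf ?lt_eqF// scaleN1r.
  by rewrite mulNr mulrN opprK.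
- rewrite t0 in hD *; have := hF s 0 hD; rewrite oppr0 => /(congr1 (@hc2 R)) /= h.
  suff -> : hc2 (F (s, 0)) = 0 by rewrite !mulr0.
  apply: (@scalerI R _ 2%:R); first by rewrite pnatr_eq0.
  by rewrite scaler0 scaler_nat mulr2n {1}h addNr.
Qed.

(** Consistency of [star_pow] with x - q and its reciprocal. *)
Lemma stem_lin q : stem setT (lin_stem q).
Proof. by move=> s t _; rewrite /lin_stem /hcbar /= scaleNr. Qed.

Lemma star_pow1 q (s t : R) I : imag_unit I ->
  star_pow q (Posz 1) (s%:A + t *: I) = s%:A + t *: I - q.
Proof.
move=> hI; rewrite /star_pow (@induced_stemE setT)//; last first.
  by move=> u v _; rewrite !expr1; exact: stem_lin.
by rewrite expr1 /= -scalerAr mulr1 addrAC.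
Qed.

End SliceFunctions.

(* Main.v *)
From Pilot Require (* MathComp-Analysis shadows [induced]. *)
Import Defs.
From mathcomp Require Import all_boot all_order all_algebra.
From mathcomp Require Import all_classical all_reals all_analysis.
From mathcomp Require Import ring lra.

(** Conjugation by a nonzero quaternion u is an isometric real-algebra
    automorphism of H acting transitively on every sphere s + t S.  All the
    notions involved (circular sets, the annuli Sigma, star powers, Laurent
    series) are equivariant under it.  A slice preserving f has a stem function
    with real components, hence commutes with it.  So conjugating a Laurent
    expansion of f at q gives one at u q u^-1, whose coefficients vanish at the
    same indices. *)

Set Implicit Arguments.
Unset Strict Implicit.
Unset Printing Implicit Defensive.

Import Order.TTheory GRing.Theory Num.Theory.
Import numFieldNormedType.Exports.
(* MathComp-Analysis shadows [induced]. *)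
Import Defs.

Local Open Scope classical_set_scope.
Local Open Scope ring_scope.

(** * Conjugation as an isometric automorphism of the quaternions *)

Section Rotations.
Variable R : realType.
Implicit Types (u x y q I J : quat R) (w : hc R).

Definition rot u x : quat R := u * x * u^-1.

Lemma quat_unit x : (x \is a GRing.unit) = (x != 0).
Proof. by []. Qed.

Lemma qre_mulC x y : qre (x * y) = qre (y * x).
Proof. by case: x y => [? ? ? ?] [? ? ? ?] /=; ring. Qed.

(** Only the real part and linear operations occur on the right, so commutation with [rot u] follows
    from the invariance of the real part. *)
Lemma qconjE x : qconj x = (qre x *+ 2)%:A - x.
Proof.
by case: x => a b c d; rewrite /qconj /GRing.scale /= /qscale qaddE /qadd /=;
  congr Quat; ring.
Qed.

Lemma qnormsqE x : qnormsq x = qre (x * qconj x).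
Proof. by case: x => a b c d; rewrite /qnormsq /=; ring. Qed.

Section Unit.
Variable u : quat R.
Hypothesis uU : u \is a GRing.unit.

Lemma rotK : cancel (rot u) (rot u^-1).
Proof. by move=> x; rewrite /rot invrK !mulrA mulVr// mul1r mulrVK. Qed.

Lemma rotVK : cancel (rot u^-1) (rot u).
Proof. by move=> x; rewrite /rot invrK !mulrA divrr// mul1r mulrK. Qed.

Lemma rotD : {morph rot u : x y / x + y}.
Proof. by move=> x y; rewrite /rot mulrDr mulrDl. Qed.

Lemma rotN : {morph rot u : x / - x}.
Proof. by move=> x; rewrite /rot mulrN mulNr. Qed.

Lemma rotB : {morph rot u : x y / x - y}.
Proof. by move=> x y; rewrite rotD rotN. Qed.

Lemma rot0 : rot u 0 = 0.
Proof. by rewrite /rot mulr0 mul0r. Qed.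

Lemma rot1 : rot u 1 = 1.
Proof. by rewrite /rot mulr1 divrr. Qed.

Lemma rotM : {morph rot u : x y / x * y}.
Proof. by move=> x y; rewrite /rot !mulrA mulrVK. Qed.

Lemma rotZ a : {morph rot u : x / a *: x}.
Proof. by move=> x; rewrite /rot -(scalerAr a u x) -(scalerAl a (u * x)). Qed.

Lemma rotA a : rot u a%:A = a%:A.
Proof. by rewrite rotZ rot1. Qed.

Lemma rotV : {morph rot u : x / x^-1}.
Proof.
(* The inverse of 0 is 0 by convention; this case covers the zeros of the symmetrization in
   [star_recip]. *)
move=> x; have [->|x0] := eqVneq x 0; first by rewrite invr0 rot0 invr0.
have xU : x \is a GRing.unit by rewrite quat_unit.
by rewrite /rot !invrM ?unitrV ?unitrMl ?unitrV// invrK mulrA.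
Qed.

Lemma qre_rot x : qre (rot u x) = qre x.
Proof. by rewrite /rot qre_mulC mulrA mulVr// mul1r. Qed.

Lemma qim_rot x : qim (rot u x) = rot u (qim x).
Proof. by rewrite /qim qre_rot rotB rotA. Qed.

Lemma qconj_rot x : qconj (rot u x) = rot u (qconj x).
Proof. by rewrite !qconjE qre_rot rotB rotA. Qed.

Lemma norm_rot x : `|rot u x| = `|x|.
Proof.
have -> : `|rot u x| = qnorm (rot u x) by [].
by rewrite /qnorm qnormsqE qconj_rot -rotM qre_rot -qnormsqE.
Qed.

Lemma imag_unit_rot I : imag_unit I -> imag_unit (rot u I).
Proof. by move=> hI; rewrite /imag_unit /= -rotM hI rotN rot1. Qed.

Lemma slice_plane_rot I x : slice_plane I x -> slice_plane (rot u I) (rot u x).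
Proof. by case=> s [t ->]; exists s, t; rewrite rotD rotA rotZ. Qed.

Lemma Omega_rot D x : Omega D x -> Omega D (rot u x).
Proof.
case=> s [t [I [Dst hI ->]]]; exists s, t, (rot u I).
by rewrite rotD rotA rotZ; split=> //; exact: imag_unit_rot.
Qed.

Lemma Sigma_annulus_rot q r x :
  Sigma_annulus q r x -> Sigma_annulus (rot u q) r (rot u x).
Proof.
case=> [[a [b [J [hJ -> h1 h2]]]]|[I [hI Iq Ix hx]]].
- left; exists a, b, (rot u J).
  rewrite /= rotD rotA rotZ qre_rot qim_rot norm_rot.
  by split=> //; exact: imag_unit_rot.
- right; exists (rot u I); rewrite -rotB norm_rot.
  split=> //; [exact: imag_unit_rot | exact: slice_plane_rot ..].
Qed.

(** * Equivariance of induced functions, star powers and Laurent sums *)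

Definition hcrot w : hc R := HC (rot u (hc1 w)) (rot u (hc2 w)).

Lemma hcrotM : {morph hcrot : v w / v * w}.
Proof.
by move=> v w; rewrite /hcrot /= rotB rotD !rotM.
Qed.

Lemma hcrotX n : {morph hcrot : w / w ^+ n}.
Proof.
move=> w; elim: n => [|n ih]; last by rewrite !exprS hcrotM ih.
by rewrite !expr0 /hcrot /= rot1 rot0.
Qed.

Lemma hcrot_conj w : hcrot (hcconj w) = hcconj (hcrot w).
Proof. by rewrite /hcrot /hcconj /= !qconj_rot. Qed.

(** [rot u] fixes the real part and the norm of the imaginary part, so both stem functions are
    evaluated at the same point. At real [x] the imaginary unit is replaced by 0, which [rot u]
    fixes too. *)
Lemma induced_rot F x : rot u (induced F x) = induced (hcrot \o F) (rot u x).
Proof.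
by rewrite /induced /= qre_rot qim_rot norm_rot rotD rotM rotZ.
Qed.

Lemma star_recip_rot F x :
  rot u (star_recip F x) = star_recip (hcrot \o F) (rot u x).
Proof.
have rec1 : hcrot \o (fun z => hcconj (F z) * F z) =
    (fun z => hcconj ((hcrot \o F) z) * (hcrot \o F) z).
  by apply/funext => z /=; rewrite hcrotM hcrot_conj.
have rec2 : hcrot \o (fun z => hcconj (F z)) =
    (fun z => hcconj ((hcrot \o F) z)).
  by apply/funext => z /=; rewrite hcrot_conj.
by rewrite /star_recip rotM rotV !induced_rot rec1 rec2.
Qed.

Lemma lin_stem_rot q z : hcrot (lin_stem q z) = lin_stem (rot u q) z.
Proof. by rewrite /hcrot /lin_stem /= rotB !rotA. Qed.

Lemma star_pow_rot q n x :
  rot u (star_pow q n x) = star_pow (rot u q) n (rot u x).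
Proof.
have powE k : hcrot \o (fun z => lin_stem q z ^+ k) =
    (fun z => lin_stem (rot u q) z ^+ k).
  by apply/funext => z /=; rewrite hcrotX lin_stem_rot.
case: n => n; rewrite /star_pow.
- by rewrite induced_rot powE.
- by rewrite star_recip_rot powE.
Qed.

Lemma cvg_rot (v : nat -> quat R) y :
  v @ \oo --> y -> (rot u \o v) @ \oo --> rot u y.
Proof.
move=> /cvgrPdist_lt vy; apply/cvgrPdist_lt => e e0.
by near=> n; rewrite /= -rotB norm_rot; near: n; exact: vy.
Unshelve. all: by end_near. Qed.

Lemma laurent_sum_rot q (a : int -> quat R) x y :
  laurent_sum q a x y ->
  laurent_sum (rot u q) (rot u \o a) (rot u x) (rot u y).
Proof.
have rot_series (v v' : nat -> quat R) : (forall n, v' n = rot u (v n)) ->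
    series v' = rot u \o series v.
  move=> e; apply/funext => n /=; rewrite /series /= (big_morph _ rotD rot0).
  by apply: eq_bigr => i _; rewrite e.
case=> y1 [y2 [h1 h2 ->]]; exists (rot u y1), (rot u y2); rewrite rotD.
split=> //.
- rewrite (rot_series (fun n => star_pow q (Posz n) x * a (Posz n))).
    exact: cvg_rot h1.
  by move=> n; rewrite rotM star_pow_rot.
- rewrite (rot_series (fun n => star_pow q (Negz n) x * a (Negz n))).
    exact: cvg_rot h2.
  by move=> n; rewrite rotM star_pow_rot.
Qed.

End Unit.

(** A circular set is stable under conjugation, so the same [D] serves both centres. *)
Lemma regular_around_rot u q r f : u \is a GRing.unit ->
  regular_around q r f -> regular_around (rot u q) r f.
Proof.
move=> uU [r0 [D [sD fD]]]; split=> //; exists D; split=> // x hx.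
rewrite -(rotVK uU x); apply: (Omega_rot uU); apply: sD.
by rewrite -(rotK uU q); apply: Sigma_annulus_rot => //; rewrite unitrV.
Qed.

(** * Transitivity of conjugation on spheres *)

(** For every w, u = w I + J w satisfies u I = J u.  If u vanishes for w = 1,
    then J = - I; it cannot vanish for w = i and w = j as well, since I would
    then be central. *)
Lemma rot_transitive I J : imag_unit I -> imag_unit J ->
  exists2 u, u \is a GRing.unit & rot u I = J.
Proof.
move=> hI hJ.
have key (w : quat R) : w * I + J * w != 0 ->
    exists2 u, u \is a GRing.unit & rot u I = J.
  move=> u0; exists (w * I + J * w); first by rewrite quat_unit.
  apply: (canLR (mulrK _)); first by rewrite quat_unit.
  rewrite mulrDl mulrDr -mulrA hI !mulrA hJ mulrN1 mulN1r.
  by rewrite addrC.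
have [e1|] := eqVneq (1 * I + J * 1) 0; last exact: key.
have [e2|] := eqVneq (Quat 0 1 0 0 * I + J * Quat 0 1 0 0) 0; last exact: key.
have [e3|] := eqVneq (Quat 0 0 1 0 * I + J * Quat 0 0 1 0) 0; last exact: key.
exfalso; move: e1; rewrite mul1r mulr1 => /eqP; rewrite addr_eq0 => /eqP eI.
have [I0 nI] := imag_unitP hI; move: e2 e3 I0 nI.
have -> : J = - I by rewrite eI opprK.
case: I {hI hJ key J eI} => a b c d; rewrite /qnormsq /=.
move=> [e1 e2 e3 e4] [f1 f2 f3 f4] a0.
have c0 : c = 0 by lra.
have d0 : d = 0 by lra.
have b0 : b = 0 by lra.
rewrite a0 b0 c0 d0; lra.
Qed.

Lemma sphere_of_rot u q q' : u \is a GRing.unit ->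
  sphere_of q q' -> sphere_of (rot u q) q'.
Proof. by move=> uU; rewrite /sphere_of /= qre_rot// qim_rot// norm_rot. Qed.

Lemma imag_unitN J : imag_unit J -> imag_unit (- J).
Proof. by rewrite /imag_unit /= mulrNN. Qed.

Lemma sphere_rot D q q' : Omega D q -> sphere_of q q' ->
  exists2 u, u \is a GRing.unit & q' = rot u q.
Proof.
case=> s [t [I [_ hI ->]]] [J hJ].
rewrite qre_repr// qim_repr// qnorm_repr//.
(* The sphere is parametrized by the absolute value of [t]; for negative [t] the unit [I] must be
   sent to [- J]. *)
have [_|_] := ger0P t => ->.
  have [u uU uI] := rot_transitive hI hJ; exists u => //.
  by rewrite rotD rotA// rotZ uI.
have [u uU uI] := rot_transitive hI (imag_unitN hJ).
by exists u => //; rewrite rotD rotA// rotZ uI scalerN scaleNr.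
Qed.

(** * Slice preserving functions commute with conjugation *)

(** The planes of i and j already meet only in the real axis. *)
Lemma slice_plane_all_real x :
  (forall J, imag_unit J -> slice_plane J x) -> x = (qre x)%:A.
Proof.
move=> h.
have m1 : -1 = Quat (-1) (- 0) (- 0) (- 0) :> quat R by [].
have iu : imag_unit (Quat 0 1 0 0 : quat R).
  by rewrite /imag_unit /= m1 /GRing.mul /=; congr Quat; ring.
have ju : imag_unit (Quat 0 0 1 0 : quat R).
  by rewrite /imag_unit /= m1 /GRing.mul /=; congr Quat; ring.
have [s [t e]] := h _ iu; have [s' [t' e']] := h _ ju.
move: e e'; case: x {h} => a b c d; rewrite !qaddE /qadd /= /GRing.scale /= /qscale /=.
by move=> [-> -> -> ->] [e1 e2 e3 e4]; congr Quat; lra.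
Qed.

Lemma slice_plane_half J x : slice_plane J (x *+ 2) -> slice_plane J x.
Proof.
case=> s [t e]; exists (s / 2), (t / 2).
apply: (@scalerI R _ 2%:R); first by rewrite pnatr_eq0.
rewrite scaler_nat e scalerDr !scalerA.
by congr (_ *: _ + _ *: _); field.
Qed.

Lemma slice_planeD J x y :
  slice_plane J x -> slice_plane J y -> slice_plane J (x + y).
Proof.
by case=> s [t ->] [s' [t' ->]]; exists (s + s'), (t + t');
  rewrite !scalerDl addrACA.
Qed.

Lemma slice_planeN J x : slice_plane J x -> slice_plane J (- x).
Proof.
by case=> s [t ->]; exists (- s), (- t); rewrite !scaleNr opprD.
Qed.

Lemma slice_planeMl J x : imag_unit J ->
  slice_plane J x -> slice_plane J (J * x).
Proof.
move=> hJ [s [t ->]]; exists (- t), s.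
by rewrite mulrDr -!scalerAr mulr1 hJ scalerN -scaleNr addrC.
Qed.

Lemma slice_planeNr J x : slice_plane (- J) x -> slice_plane J x.
Proof. by case=> s [t ->]; exists s, (- t); rewrite scalerN scaleNr. Qed.

(** The values at s + tJ and s - tJ both lie in the plane of J. Their half-sum and half-difference
    put both components of [F (s, t)] in that plane, for every J; hence they are real and fixed by
    [rot u]. *)
Lemma slice_preserving_rot D E f u x y : slice_preserving D f ->
  regular_on E f -> u \is a GRing.unit -> Omega D x -> Omega E x ->
  f x = Some y -> f (rot u x) = Some (rot u y).
Proof.
move=> fp [_ _ [F [sF _ fF]]] uU Dx [s [t [I [Est hI ex]]]].
have xJ J : imag_unit J -> exists2 v, v \is a GRing.unit &
    s%:A + t *: J = rot v x.
  move=> hJ; have [v vU vI] := rot_transitive hI hJ; exists v => //.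
  by rewrite ex rotD rotA// rotZ vI.
have fJ J : imag_unit J ->
    f (s%:A + t *: J) = Some (hc1 (F (s, t)) + J * hc2 (F (s, t))).
  move=> hJ; rewrite fF; last by exists s, t, J.
  by rewrite (induced_stemE sF Est hJ).
have PJ J : imag_unit J -> slice_plane J (hc1 (F (s, t)) + J * hc2 (F (s, t))).
  move=> hJ; apply: (fp _ hJ _ _ _ _ (fJ J hJ)); last by exists s, t.
  by have [v vU ->] := xJ _ hJ; exact: Omega_rot.
have QJ J : imag_unit J -> slice_plane J (hc1 (F (s, t)) - J * hc2 (F (s, t))).
  move=> hJ; apply: slice_planeNr; rewrite -mulNr.
  by apply: PJ; exact: imag_unitN.
have /slice_plane_all_real e1 J : imag_unit J -> slice_plane J (hc1 (F (s, t))).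
  move=> hJ; apply: slice_plane_half.
  by have := slice_planeD (PJ J hJ) (QJ J hJ); rewrite addrACA subrr addr0.
have /slice_plane_all_real e2 J : imag_unit J -> slice_plane J (hc2 (F (s, t))).
  move=> hJ; apply: slice_plane_half.
  have := slice_planeD (PJ J hJ) (slice_planeN (QJ J hJ)).
  rewrite opprB [X in _ + X]addrC addrACA subrr add0r -mulrDr -mulr2n.
  (* Multiplication by [- J], the inverse of [J], recovers twice the second component. *)
  move=> /(slice_planeMl hJ)/slice_planeN.
  by rewrite mulrA hJ mulN1r opprK.
rewrite ex fJ// => -[<-].
have -> : rot u (s%:A + t *: I) = s%:A + t *: rot u I by rewrite rotD rotA// rotZ.
rewrite fJ; last exact: imag_unit_rot.
by rewrite rotD rotM// e1 e2 !rotA.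
Qed.

(** * Annuli inside the domain *)

Lemma Sigma_annulusS q r r' : r' <= r ->
  Sigma_annulus q r' `<=` Sigma_annulus q r.
Proof.
move=> rr x [[a [b [J [hJ ex /andP[h1 h2] /andP[h3 h4]]]]]
  |[I [hI Iq Ix /andP[h1 h2]]]].
- left; exists a, b, J; split=> //.
  + by rewrite h1 (lt_le_trans h2).
  + by rewrite h3 (lt_le_trans h4).
- by right; exists I; split=> //; rewrite h1 (lt_le_trans h2).
Qed.

(** The balls of [R * R] are taken for the max norm, while [cdist] is Euclidean; this compares the
    two. *)
Lemma cdist_ge (s t a b : R) :
  `|s - a| <= cdist s t a b /\ `|t - b| <= cdist s t a b.
Proof.
by rewrite /cdist -!sqrtr_sqr; split; apply: ler_wsqrtr;
  rewrite ?lerDl ?lerDr sqr_ge0.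
Qed.

Lemma norm_slice (a b : R) I : imag_unit I ->
  `|a%:A + b *: I| = Num.sqrt (a ^+ 2 + b ^+ 2).
Proof.
move=> /imag_unitP[I0 nI].
have -> : `|a%:A + b *: I| = qnorm (a%:A + b *: I) by [].
rewrite /qnorm; congr Num.sqrt; rewrite -[b ^+ 2]mulr1 -nI.
move: I0; case: I {nI} => c d e f /= ->.
by rewrite /qnormsq /=; ring.
Qed.

(** Slice preservation is given on [Omega D] only, whereas a Laurent expansion may live on a set
    reaching beyond it; this radius confines the annulus. *)
Lemma Sigma_annulus_sub D q : open D -> conj_symmetric D -> Omega D q ->
  exists2 r, 0 < r & Sigma_annulus q r `<=` Omega D.
Proof.
move=> oD cD [s [t [I [Dst hI ->]]]].
have /nbhs_ballP[e /= e0 sub] : nbhs (s, t) D by exact: open_nbhs_nbhs.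
(* The centre [(c, d)] is [(s, t)] or its conjugate; in the second case [(a, b)] is reflected into
   the ball around [(s, t)]. *)
have close a b c d : c = s -> `|d| = `|t| -> cdist a b c d < e -> D (a, b).
  move=> -> /eqP; rewrite eqr_norm2 => ht he.
  have [h1 h2] := cdist_ge a b s d.
  have h1' := le_lt_trans h1 he; have h2' := le_lt_trans h2 he.
  case/orP: ht h2' => /eqP -> h2'.
    by apply: sub; split; rewrite /ball /= distrC.
  rewrite -[b]opprK; apply: cD; apply: sub; split.
    by rewrite /ball /= distrC.
  by rewrite /ball /= opprK addrC; move: h2'; rewrite opprK.
exists e => // x [[a [b [J [hJ -> /andP[_ h2] _]]]]|[J [hJ [c [d eq]] [a [b ->]]]]].
- exists a, b, J; split=> //; move: h2; rewrite qre_repr// qim_repr// qnorm_repr//.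
  by apply: close; rewrite ?normr_id.
(* Here [J] is [I] or [- I], or arbitrary when [q] is real, so [d] is determined by [t] only up to
   sign. *)
- move=> /andP[_]; rewrite eq => h; exists a, b, J; split=> //.
  have ec : c = s by rewrite -(qre_repr s t hI) eq qre_repr.
  have ed : `|d| = `|t|.
    by rewrite -(qnorm_repr t hI) -(qim_repr s t hI) eq qim_repr// qnorm_repr.
  apply: (close a b c d) => //.
  suff <- : `|a%:A + b *: J - (c%:A + d *: J)| = cdist a b c d by [].
  by rewrite opprD addrACA -!scalerBl norm_slice.
Qed.

(** * Transport of poles and their orders *)

Lemma pole_bound_rot D f u q m : slice_domain D -> slice_preserving D f ->
  u \is a GRing.unit -> Omega D q -> pole_bound f q m ->
  pole_bound f (rot u q) m.
Proof.
move=> [oD cD _ _ _] fp uU Dq [a [r [[r0 [E [sE fE]]] fa]] am].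
have [r1 r10 sD] := Sigma_annulus_sub oD cD Dq.
exists (rot u \o a); last by move=> k mk; rewrite /= am// rot0.
have sr : Sigma_annulus q (Num.min r r1) `<=` Sigma_annulus q r.
  by apply: Sigma_annulusS; rewrite ge_min lexx.
have sr1 : Sigma_annulus q (Num.min r r1) `<=` Sigma_annulus q r1.
  by apply: Sigma_annulusS; rewrite ge_min lexx orbT.
(* The expansion holds up to radius [r]; up to [r1] the annulus stays in [Omega D], where [f] is
   slice preserving. *)
exists (Num.min r r1); split.
  apply: regular_around_rot => //; split; first by rewrite lt_min r0.
  by exists E; split=> // x /sr/sE.
move=> x; rewrite -(rotVK uU x); set x0 := rot u^-1 x => hx.
have {}hx : Sigma_annulus q (Num.min r r1) x0.
  rewrite -(rotK uU q) -(rotK uU x0).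
  by apply: Sigma_annulus_rot; rewrite ?unitrV.
have [y fy ay] := fa _ (sr _ hx).
exists (rot u y); last exact: laurent_sum_rot.
apply: (slice_preserving_rot fp fE) => //; first exact/sD/sr1.
exact/sE/sr.
Qed.

End Rotations.

Theorem lemma1p30 (R : realType) (D : set (R * R))
    (f : quat R -> option (quat R)) (hD : slice_domain D)
    (hf : semiregular D f) (hp : slice_preserving D f)
    (q : quat R) (hq : Omega D q) (hpole : is_pole f q)
    (q' : quat R) (hq' : sphere_of q q') :
  is_pole f q' /\ pole_order f q' = pole_order f q.
Proof.
have [u uU ->] := sphere_rot hq hq'.
have uVU : u^-1 \is a GRing.unit by rewrite unitrV.
have pbE m : pole_bound f (rot u q) m <-> pole_bound f q m.
  split; last exact: pole_bound_rot hD hp uU hq.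
  (* The converse is the same transport, by the inverse of [u]. *)
  rewrite -{2}(rotK uU q); apply: pole_bound_rot hD hp uVU _.
  exact: Omega_rot.
case: hpole => [[r fr] nrem [m fm]]; split.
  split; first by exists r; exact: regular_around_rot.
  (* A regular extension at [rot u q] lives on a circular set, which also contains [q], and both
     points have the same sphere. *)
  - case=> _ [E [g [Eq gE gf]]]; apply: nrem; split; first by exists r.
    exists E, g; split=> //; first by rewrite -(rotK uU q); exact: Omega_rot.
    move=> x Ex nx; apply: gf => // hx; apply: nx.
    by rewrite -(rotK uU q); exact: sphere_of_rot.
  - by exists m; exact/pbE.
(* Both points have the same pole bounds, so [xget] chooses from equal sets. *)
rewrite /pole_order; congr xget; apply/seteqP; split=> k /= [hk kmin].
- by split=> [|m' hm']; [exact/pbE | apply: kmin; exact/pbE].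
- by split=> [|m' hm']; [exact/pbE | apply: kmin; exact/pbE].
Qed.
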